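(* For $l\ge4$, let $(p_1,p_2,\dots,p_l)$ be an $l$-tuple of pairwise relatively prime integers with $1<p_1<p_2<\dots<p_l$. Let $(e_0,p_1',\dots,p_l')$ be the integers determined by $$e_0p_1p_2\cdots p_l+p_1'p_2\cdots p_l+p_1p_2'\cdots p_l+\cdots+p_1p_2\cdots p_l'=-1,\qquad 0\le p_i'\le p_i-1\ (i=1,\dots,l),$$ and let $\Delta:\mathbb{N}\to\mathbb{Z}$ (with $0\in\mathbb{N}$) be $$\Delta(n)=1+|e_0|n-\sum_{i=1}^l\left\lceil\frac{np_i'}{p_i}\right\rceil .$$ Define $$N_0=p_1p_2\cdots p_l\left((l-2)-\sum_{i=1}^l\frac1{p_i}\right)\in\mathbb{Z}_{>0}.$$ Then: 1. $\Delta(n)\ge0$ for all $n>N_0$. 2. $\Delta(n)=-\Delta(N_0-n)$ for $0\le n\le N_0$. 3. $\Delta(n)\in\{-(l-2),\dots,-1,0,1,\dots,l-2\}$ for $0\le n\le N_0$. 4. For $0\le n\le N_0$, one has $\Delta(n)\ge1$ if and only if either $n=0$, or $n$ is an element of the numerical semigroup $G$ minimally generated by $p_1p_2\cdots p_l/p_i$ for $i=1,2,\dots,l$. 5. If $n\in G$ is of the form $n=p_1p_2\cdots p_l\sum_{i=1}^l\frac{x_i}{p_i}$ (with $x_i$ non-negative integers), then $\Delta(n)=1+\sum_{i=1}^l\left\lfloor\frac{x_i}{p_i}\right\rfloor$.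
   Context: $\lceil y\rceil$ and $\lfloor y\rfloor$ denote the ceiling and floor of $y$. *)

(* Defs.v *)
From mathcomp Require Import all_boot all_order all_algebra.
From mathcomp Require Import classical_sets cardinality.
Set Implicit Arguments.
Unset Strict Implicit.
Unset Printing Implicit Defensive.
Import Order.TTheory GRing.Theory Num.Theory.
Local Open Scope classical_set_scope.
Local Open Scope ring_scope.

(* The indices 1, ..., l are represented by 'I_l = {0, ..., l - 1}. *)

Definition seifert_eq (l : nat) (p : 'I_l -> nat) (e0 : int) (p' : 'I_l -> int)
  : Prop :=
  e0 * (\prod_(j < l) p j)%N%:Z
    + \sum_(i < l) p' i * (\prod_(j < l | j != i) p j)%N%:Z = -1.

Definition Delta (l : nat) (p : 'I_l -> nat) (e0 : int) (p' : 'I_l -> int)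
    (n : nat) : int :=
  1 + `|e0| * n%:Z
    - \sum_(i < l) Num.ceil (n%:Q * (p' i)%:Q / (p i)%:Q).

Definition submonoid (S : set nat) : Prop :=
  S 0%N /\ forall m n, S m -> S n -> S (m + n)%N.

Definition numerical_semigroup (S : set nat) : Prop :=
  submonoid S /\ finite_set (~` S).

(* A numerical semigroup contains 0, so "generated" means generated as an
   additive submonoid of nat. *)
Definition generated (A : set nat) : set nat := smallest submonoid A.

Definition minimally_generates (A S : set nat) : Prop :=
  generated A = S /\ forall B : set nat, B `<` A -> generated B <> S.

(* The division is exact. *)
Definition generators (l : nat) (p : 'I_l -> nat) : set nat :=
  range (fun i : 'I_l => ((\prod_(j < l) p j) %/ p i)%N).

(* Main.v *)
Require Import Defs.
From mathcomp Require Import all_boot all_order all_algebra.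
From mathcomp Require Import boolp classical_sets cardinality.
From mathcomp Require Import ring zify.
Import Order.TTheory GRing.Theory Num.Theory.
Set Implicit Arguments.
Unset Strict Implicit.
Unset Printing Implicit Defensive.
Local Open Scope classical_set_scope.
Local Open Scope ring_scope.

(** Write [P] for the product of the [p i] and [q i = P / p i].  Any integral
expression [n = \sum_i y i * q i + k * P] gives
[Delta n = 1 + k + \sum_i floor (y i / p i)], because the defining equation
makes [p i] divide [n * p' i + y i].  Taking [y i] to be the residue of
[- n * p' i] modulo [p i] shows that every [n] has such an expression with
[0 <= y i < p i]; there [Delta n = 1 + k], and [k >= 0] exactly when [n] lies
in the semigroup.  Replacing [y i] by [p i - 1 - y i] and [k] by [- 2 - k]
turns the expression of [n] into one of [N0 - n]. *)

(** * Rounded quotients as integer division *)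

Lemma floor_ratio (m : int) (d : nat) :
  Num.floor (m%:Q / d%:Q) = (m %/ d)%Z.
Proof.
(* For [d = 0] both sides are 0, since dividing by 0 gives 0 in [rat] and in [int]. *)
case: d => [|d]; first by rewrite invr0 mulr0 divz0 floor0.
have d_gt0 : 0 < (d.+1%:Z)%:Q by rewrite ltr0z.
apply: floor_def; rewrite ler_pdivlMr // ltr_pdivrMr // -!intrM ler_int ltr_int.
by rewrite lez_floor // ltz_ceil.
Qed.

Lemma ceil_ratio (m : int) (d : nat) :
  Num.ceil (m%:Q / d%:Q) = - ((- m) %/ d)%Z.
Proof. by rewrite ceilNfloor -mulNr -mulrNz floor_ratio. Qed.

Lemma submonoid_generated (A : set nat) : submonoid (generated A).
Proof.
split=> [M [[M0 _] _] //|m n Am An M MA].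
by have [[_ MD] _] := MA; apply: MD; [apply: Am | apply: An].
Qed.

(** * Cofactors and the semigroup they generate *)

Definition cofactor (l : nat) (p : 'I_l -> nat) (i : 'I_l) : nat :=
  \prod_(j < l | j != i) p j.

Section Cofactors.

Variables (l : nat) (p : 'I_l -> nat).
Hypothesis p_gt0 : forall i, (0 < p i)%N.

Let P := (\prod_(i < l) p i)%N.
Let q := cofactor p.

Lemma prod_cofactor i : P = (p i * q i)%N.
Proof. by rewrite /P (bigD1 i). Qed.

Lemma dvdn_prod i : (p i %| P)%N.
Proof. by rewrite (prod_cofactor i) dvdn_mulr. Qed.

Lemma cofactorE i : (P %/ p i)%N = q i.
Proof. by rewrite (prod_cofactor i) mulKn. Qed.

Lemma dvdn_cofactor i j : j != i -> (p i %| q j)%N.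
Proof. by move=> ji; rewrite /q /cofactor (bigD1 i) 1?eq_sym //= dvdn_mulr. Qed.

Lemma prod_gt0 : (0 < P)%N.
Proof. by rewrite prodn_gt0. Qed.

Lemma sum_ratio (x : 'I_l -> int) :
  P%:Q * (\sum_i (x i)%:Q / (p i)%:Q) = (\sum_i x i * (q i)%:Z)%:Q.
Proof.
rewrite mulr_sumr rmorph_sum /=; apply: eq_bigr => i _.
have pi0 : ((p i)%:Z)%:Q != 0 by rewrite intr_eq0; have := p_gt0 i; lia.
by rewrite (prod_cofactor i) PoszM !intrM; field.
Qed.

Lemma sum_ratio_nat (n : nat) (x : 'I_l -> nat) :
  n%:Q = P%:Q * (\sum_i (x i)%:Q / (p i)%:Q) ->
  n%:Z = \sum_i (x i)%:Z * (q i)%:Z.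
Proof. by rewrite sum_ratio => /intr_inj. Qed.

(** The combinations form a submonoid containing the generators, and any submonoid containing the
    generators contains all combinations. *)
Lemma generated_generatorsP n :
  generated (generators p) n <->
  exists x : 'I_l -> nat, n = (\sum_i x i * q i)%N.
Proof.
split; last first.
  move=> [x ->] M [[M0 MD] gM]; elim/big_ind: _ => // i _.
  have Mq : M (q i) by apply: gM; exists i => //=; rewrite cofactorE.
  by elim: (x i) => [|k IHk] //; rewrite mulSn; apply: MD.
pose combs n := exists x : 'I_l -> nat, n = (\sum_i x i * q i)%N.
apply: (smallest_sub (X := combs)).
  split; first by exists (fun=> 0%N); rewrite big1.
  move=> m k [x ->] [y ->]; exists (fun i => x i + y i)%N.
  by rewrite -big_split; apply: eq_bigr => i _; rewrite mulnDl.
move=> _ [i _ <-]; exists (fun j => nat_of_bool (j == i)).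
rewrite cofactorE (bigD1 i) //= eqxx mul1n big1 ?addn0 // => j.
by move/negPf ->.
Qed.

Lemma cofactor_gt0 i : (0 < q i)%N.
Proof. by rewrite /q /cofactor prodn_gt0. Qed.

(** This is the positivity of [N0]. Each [2 * q i] is at most [P], strictly less at [i1], so twice
    the sum is below [l * P]; and [l <= 2 * (l - 2)] because [l >= 4]. *)
Lemma sum_cofactor_lt (i1 : 'I_l) :
  (4 <= l)%N -> (forall i, (1 < p i)%N) -> (2 < p i1)%N ->
  (\sum_i q i < (l - 2) * P)%N.
Proof.
move=> l_ge4 p_gt1 pi1_gt2.
have lt2 : (\sum_i 2 * q i < \sum_(i < l) P)%N.
  rewrite (bigD1 i1) // [X in (_ < X)%N](bigD1 i1) //= -addSn leq_add //.
    by rewrite (prod_cofactor i1) ltn_pmul2r ?cofactor_gt0.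
  by apply: leq_sum => i _; rewrite (prod_cofactor i) leq_pmul2r ?cofactor_gt0.
move: lt2; rewrite -big_distrr sum_nat_const card_ord /= => lt2.
rewrite -(ltn_pmul2l (isT : (0 < 2)%N)); apply: (leq_trans lt2).
by rewrite mulnA leq_mul2r; apply/orP; right; lia.
Qed.

End Cofactors.

(** * Minimality of the generating set *)

Section MinimalGeneration.

Variables (l : nat) (p : 'I_l -> nat).
Hypothesis p_gt1 : forall i, (1 < p i)%N.
Hypothesis p_coprime : forall i j : 'I_l, i != j -> coprime (p i) (p j).

Let p_gt0 i : (0 < p i)%N.
Proof. exact: ltnW. Qed.

(** The cofactor is a product of integers coprime to [p i], so divisibility would force
    [p i = 1]. *)
Lemma cofactor_not_dvdn i : ~~ (p i %| cofactor p i)%N.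
Proof.
have co : coprime (p i) (cofactor p i).
  rewrite /cofactor; elim/big_rec: _ => [|j m ji co]; first exact: coprimen1.
  by rewrite coprimeMr co p_coprime // eq_sym.
by apply/negP => d; move: co; rewrite /coprime (gcdn_idPl d); have := p_gt1 i; lia.
Qed.

(* Without the i-th generator, all remaining generators are multiples of
   [p i], whereas [cofactor p i] is not. *)
Lemma generators_minimal :
  minimally_generates (generators p) (generated (generators p)).
Proof.
split=> // B [ltBA /= nAB] eqBG.
apply: nAB => _ [i _ <-]; rewrite cofactorE //.
have [//|nBq] := pselect (B (cofactor p i)).
suff : generated B `<=` [set n | p i %| n]%N.
  rewrite eqBG => sub; case/negP: (cofactor_not_dvdn i); apply: (sub).
  have gq : generators p (cofactor p i) by exists i; rewrite ?cofactorE.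
  exact: sub_gen_smallest gq.
apply: smallest_sub.
  by split=> [|m n] /=; [exact: dvdn0 | exact: dvdn_add].
move=> n Bn /=; have [j _ qj] := ltBA n Bn; move: qj Bn; rewrite cofactorE // => <- Bq.
by apply: dvdn_cofactor; apply/eqP => ji; case: nBq; rewrite -ji.
Qed.

End MinimalGeneration.

(** * Values of [Delta] from integral expressions *)

Section SeifertDelta.

Variables (l : nat) (p : 'I_l -> nat).
Hypothesis p_gt0 : forall i, (0 < p i)%N.
Variables (e0 : int) (p' : 'I_l -> int).
Hypothesis p'_ge0 : forall i, 0 <= p' i.
Hypothesis e0p'_eq : seifert_eq p e0 p'.

Let P := (\prod_(i < l) p i)%N.
Let q := cofactor p.
Let D := Delta p e0 p'.

Lemma seifert_sum : \sum_i p' i * (q i)%:Z = -1 - e0 * P%:Z.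
Proof. by rewrite -e0p'_eq addrC addKr. Qed.

(** For [e0 >= 0] the left side of the defining equation would be nonnegative. The sign turns the
    absolute value in [Delta] into [- e0]. *)
Lemma seifert_e0_lt0 : e0 < 0.
Proof.
have : 0 <= \sum_i p' i * (q i)%:Z.
  by apply: sumr_ge0 => i _; rewrite mulr_ge0.
rewrite seifert_sum ltNge => sum_ge0; apply/negP => e0_ge0.
have : 0 <= e0 * P%:Z by rewrite mulr_ge0.
lia.
Qed.

Lemma DeltaE n :
  D n = 1 - e0 * n%:Z + \sum_i ((- (n%:Z * p' i)) %/ p i)%Z.
Proof.
rewrite /D /Delta ltr0_norm ?seifert_e0_lt0 // mulNr -sumrN.
by congr (_ + _); apply: eq_bigr => i _; rewrite -intrM ceil_ratio opprK.
Qed.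

(** Modulo [p i] all other terms of the defining equation vanish, so [- p' i] is an inverse of
    [q i]. *)
Lemma seifert_dvd i : ((p i)%:Z %| p' i * (q i)%:Z + 1)%Z.
Proof.
have -> : p' i * (q i)%:Z + 1 =
    - (e0 * P%:Z + \sum_(j < l | j != i) p' j * (q j)%:Z).
  by have := seifert_sum; rewrite (bigD1 i) //=; move: (\sum_(j < l | _) _); lia.
rewrite rpredN rpredD //; first exact/dvdz_mull/dvdn_prod.
by apply: rpred_sum => j ji; apply/dvdz_mull/dvdn_cofactor.
Qed.

Lemma Delta_expr (n : nat) (y : 'I_l -> int) (k : int) :
  n%:Z = \sum_i y i * (q i)%:Z + k * P%:Z ->
  D n = 1 + k + \sum_i (y i %/ p i)%Z.
Proof.
move=> nE.
have dvd i : ((p i)%:Z %| n%:Z * p' i + y i)%Z.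
  (* The first summand is divisible because [n] is congruent to [y i * q i] modulo [p i], the second
     by [seifert_dvd]. *)
  have -> : n%:Z * p' i + y i =
      (n%:Z - y i * (q i)%:Z) * p' i + y i * (p' i * (q i)%:Z + 1) by ring.
  rewrite rpredD //; last by rewrite dvdz_mull // seifert_dvd.
  rewrite dvdz_mulr // nE (bigD1 i) //= addrAC addrAC.
  have -> a b c : a + b + c - a = b + c :> int by ring.
  rewrite rpredD //; last exact/dvdz_mull/dvdn_prod.
  by apply: rpred_sum => j ji; apply/dvdz_mull/dvdn_cofactor.
pose t i := ((n%:Z * p' i + y i) %/ p i)%Z.
have tE i : t i * (p i)%:Z = n%:Z * p' i + y i by rewrite divzK.
(* Multiplied by [P], the sum is [n * (-1 - e0 * P) + \sum_i y i * q i], that is,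
   [(- k - e0 * n) * P]. *)
have sum_t : \sum_i t i = - k - e0 * n%:Z.
  apply: (@mulIf _ P%:Z); first by have := prod_gt0 p_gt0; rewrite -/P; lia.
  rewrite mulr_suml.
  have termE i : t i * P%:Z = n%:Z * (p' i * (q i)%:Z) + y i * (q i)%:Z.
    by rewrite /P (prod_cofactor p i) PoszM mulrA tE -/q; ring.
  under eq_bigr do rewrite termE.
  rewrite big_split /= -mulr_sumr seifert_sum.
  by move/eqP: nE; rewrite -subr_eq => /eqP <-; ring.
have floorE i : ((- (n%:Z * p' i)) %/ p i)%Z = (y i %/ p i)%Z - t i.
  have -> : - (n%:Z * p' i) = (- t i) * (p i)%:Z + y i by rewrite mulNr tE; ring.
  by rewrite divzMDl 1?addrC //; have := p_gt0 i; lia.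
rewrite DeltaE; under eq_bigr do rewrite floorE.
by rewrite sumrB sum_t; ring.
Qed.

(** Divide [- (n * p' i)] by [p i] with remainder, multiply by [q i] and sum over [i]. By
    [seifert_sum] the dividends give [n * (1 + e0 * P)], and the quotients add up to
    [D n - 1 + e0 * n]. *)
Lemma canonical_expr (n : nat) : exists2 x : 'I_l -> nat,
  forall i, (x i < p i)%N &
  n%:Z = \sum_i (x i)%:Z * (q i)%:Z + (D n - 1) * P%:Z.
Proof.
pose x i := ((- (n%:Z * p' i)) %% p i)%Z.
have xE i : x i = `|x i|%N%:Z.
  by rewrite gez0_abs // modz_ge0 //; have := p_gt0 i; lia.
exists (fun i => `|x i|%N) => [i|].
  by rewrite -ltz_nat -xE ltz_pmod // ltz_nat.
under eq_bigr do rewrite -xE.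
rewrite DeltaE.
have termE i : x i * (q i)%:Z = - n%:Z * (p' i * (q i)%:Z)
    - ((- (n%:Z * p' i)) %/ p i)%Z * P%:Z.
  rewrite /P (prod_cofactor p i) PoszM -/q.
  have -> : x i = - (n%:Z * p' i) - ((- (n%:Z * p' i)) %/ p i)%Z * (p i)%:Z.
    by rewrite {1}(divz_eq (- (n%:Z * p' i)) (p i)) addrC addKr.
  ring.
under eq_bigr do rewrite termE.
by rewrite sumrB -mulr_sumr -mulr_suml seifert_sum; ring.
Qed.

Lemma Delta_ge1P (i0 : 'I_l) n : 1 <= D n <-> generated (generators p) n.
Proof.
rewrite generated_generatorsP //; split=> [Dn | [x nE]]; last first.
  rewrite (@Delta_expr n (fun i => (x i)%:Z) 0).
    by rewrite addr0 lerDl sumr_ge0 // => i _; rewrite divz_ge0 // ltz_nat.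
  rewrite mul0r addr0 nE -natz natr_sum.
  by apply: eq_bigr => i _; rewrite natz PoszM.
have [x _ nE] := canonical_expr n.
have [k kE] : exists k : nat, D n - 1 = k%:Z.
  by exists `|D n - 1|%N; rewrite gez0_abs // subr_ge0.
(* Since [P = p i0 * q i0], the nonnegative multiple [k * P] is absorbed into the coefficient of
   [q i0]. *)
exists (fun i => x i + (if i == i0 then k * p i else 0))%N.
apply/eqP; rewrite -eqz_nat nE kE -[X in _ == X]natz natr_sum /=; apply/eqP.
under [RHS]eq_bigr do rewrite natz PoszM PoszD mulrDl.
rewrite big_split /=; congr (_ + _).
rewrite (bigD1 i0) //= eqxx big1 ?addr0 => [|i /negPf ->]; last by rewrite mul0r.
by rewrite /P (prod_cofactor p i0) !PoszM mulrA.
Qed.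

(** This is the largest value of [\sum_i x i * q i] under [x i < p i]. *)
Lemma sum_cofactor_pred :
  \sum_i ((p i)%:Z - 1) * (q i)%:Z = l%:Z * P%:Z - \sum_i (q i)%:Z.
Proof.
have termE i : ((p i)%:Z - 1) * (q i)%:Z = P%:Z - (q i)%:Z.
  by rewrite /P (prod_cofactor p i) PoszM mulrBl mul1r.
under eq_bigr do rewrite termE.
by rewrite sumrB sumr_const card_ord -mulr_natl natz.
Qed.

(** The sum in the canonical expression is at most [l * P - \sum_i q i], so a large [n] forces a
    large [D n - 1]. For [c = 2] the threshold is [N0]; [c = 1] yields cofiniteness of the
    semigroup. *)
Lemma Delta_gt (n : nat) (c : int) :
  (l%:Z - c) * P%:Z - \sum_i (q i)%:Z < n%:Z -> 1 - c < D n.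
Proof.
have [x x_lt nE] := canonical_expr n; rewrite nE => lt_n.
have P_gt0 : 0 < P%:Z by rewrite ltz_nat prod_gt0.
have le_x : \sum_i (x i)%:Z * (q i)%:Z <= l%:Z * P%:Z - \sum_i (q i)%:Z.
  rewrite -sum_cofactor_pred; apply: ler_sum => i _.
  by rewrite ler_wpM2r //; have := x_lt i; lia.
rewrite -ltrBrDr -(ltr_pM2r P_gt0); lia.
Qed.

(** The sum in the canonical expression is nonnegative, so [(D n - 1) * P <= n]. *)
Lemma Delta_le (n : nat) (c : int) : n%:Z < c * P%:Z -> D n <= c.
Proof.
have [x _ nE] := canonical_expr n; rewrite {1}nE => lt_n.
have P_gt0 : 0 < P%:Z by rewrite ltz_nat prod_gt0.
have x_ge0 : 0 <= \sum_i (x i)%:Z * (q i)%:Z by rewrite sumr_ge0.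
by rewrite -[D n](subrK 1) -ltzD1 ltrD2r -(ltr_pM2r P_gt0); lia.
Qed.

Lemma Delta_sym (n m : nat) :
  (n + m)%:Z = (l%:Z - 2) * P%:Z - \sum_i (q i)%:Z -> D n = - D m.
Proof.
have [x x_lt mE] := canonical_expr m => nmE.
(* The last argument is [- 2 - k] for [k = D m - 1]. The new coefficients again lie between 0 and
   [p i - 1], so their floors vanish. *)
rewrite (@Delta_expr n (fun i => (p i)%:Z - 1 - (x i)%:Z) (- 1 - D m)).
  rewrite big1 => [|i _]; first by ring.
  by rewrite divz_small //; have := x_lt i; lia.
under eq_bigr do rewrite mulrBl.
rewrite sumrB sum_cofactor_pred.
rewrite PoszD in nmE.
by apply: (addIr m%:Z); rewrite nmE mE; ring.
Qed.

End SeifertDelta.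

(** * Semigroup properties and the five claims about [Delta] *)

Theorem theorem4p1 (l : nat) (hl : (4 <= l)%N) (p : 'I_l -> nat)
    (p_gt1 : forall i, (1 < p i)%N)
    (p_incr : forall i j : 'I_l, (i < j)%N -> (p i < p j)%N)
    (p_coprime : forall i j : 'I_l, i != j -> coprime (p i) (p j))
    (e0 : int) (p' : 'I_l -> int)
    (p'_range : forall i, 0 <= p' i <= (p i)%:Z - 1)
    (e0p'_eq : seifert_eq p e0 p') :
  let P := (\prod_(i < l) p i)%N in
  let D := Delta p e0 p' in
  let G := generated (generators p) in
  numerical_semigroup G /\ minimally_generates (generators p) G /\
  exists N0 : nat,
    (0 < N0)%N /\
    N0%:Q = P%:Q * ((l%:Q - 2) - \sum_(i < l) 1 / (p i)%:Q) /\
    (forall n : nat, (N0 < n)%N -> 0 <= D n) /\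
    (forall n : nat, (n <= N0)%N -> D n = - D (N0 - n)%N) /\
    (forall n : nat, (n <= N0)%N -> - (l%:Z - 2) <= D n <= l%:Z - 2) /\
    (forall n : nat, (n <= N0)%N -> (1 <= D n <-> n = 0%N \/ G n)) /\
    (forall (n : nat) (x : 'I_l -> nat), G n ->
       n%:Q = P%:Q * \sum_(i < l) (x i)%:Q / (p i)%:Q ->
       D n = 1 + \sum_(i < l) Num.floor ((x i)%:Q / (p i)%:Q)).
Proof.
move=> P D G.
have p_gt0 i : (0 < p i)%N := ltnW (p_gt1 i).
have p'_ge0 i : 0 <= p' i by case/andP: (p'_range i).
pose i0 : 'I_l := Ordinal (leq_trans (isT : (1 <= 4)%N) hl).
pose i1 : 'I_l := Ordinal (leq_trans (isT : (2 <= 4)%N) hl).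
(* Strict increase gives [p i1 > p i0 >= 2]; this index supplies the strictness in
   [sum_cofactor_lt]. *)
have pi1_gt2 : (2 < p i1)%N by apply: leq_ltn_trans (p_gt1 i0) (p_incr _ _ _).
have lt_N0 := sum_cofactor_lt p_gt0 hl p_gt1 pi1_gt2.
have D_ge1 n : 1 <= D n <-> G n := Delta_ge1P p_gt0 p'_ge0 e0p'_eq i0 n.
have P_gt0 : (0 < P)%N := prod_gt0 p_gt0.
set q := cofactor p in lt_N0.
have sumqE : (\sum_i q i)%N%:Z = \sum_i (q i)%:Z.
  by rewrite -natz natr_sum; under eq_bigr do rewrite natz.
split; first split; first exact: submonoid_generated.
  (* Every [n >= l * P] exceeds the threshold of [Delta_gt] for [c = 1], so all gaps lie below
     [l * P]. *)
  apply: (sub_finite_set _ (finite_II (l * P))) => n /= nG.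
  rewrite ltnNge; apply/negP => len; apply: nG; apply/D_ge1.
  rewrite -[X in X <= _]add0r lezD1.
  have := @Delta_gt _ _ p_gt0 _ _ p'_ge0 e0p'_eq n 1; rewrite subrr; apply.
  rewrite -sumqE -/P -/q; nia.
split; first exact: generators_minimal.
(* By [lt_N0] this subtraction in [nat] does not truncate. *)
exists ((l - 2) * P - \sum_i q i)%N.
set N0 := (_ - _)%N.
have N0E : N0%:Z = (l%:Z - 2) * P%:Z - \sum_i (q i)%:Z.
  by rewrite -sumqE /N0 -subzn ?(ltnW lt_N0) // PoszM -subzn // (leq_trans _ hl).
have D_sym n : (n <= N0)%N -> D n = - D (N0 - n)%N.
  by move=> len; apply: Delta_sym => //; rewrite subnKC // N0E.
have D_le n : (n <= N0)%N -> D n <= l%:Z - 2.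
  (* Positive cofactors give [N0 < (l - 2) * P]. *)
  move=> len; apply: Delta_le => //.
  have : (0 < \sum_i q i)%N by rewrite (bigD1 i0) // addn_gt0 cofactor_gt0.
  by move: N0E len; rewrite -sumqE -/P; lia.
split; first by rewrite subn_gt0.
split.
  rewrite mulrBr.
  have -> : P%:Q * (\sum_(i < l) 1 / (p i)%:Q) = (\sum_i 1 * (q i)%:Z)%:Q.
    exact: (sum_ratio p_gt0 (fun=> 1)).
  under eq_bigr do rewrite mul1r.
  by rewrite N0E rmorphB rmorphM rmorphB /= mulrC.
split.
  move=> n ltn; have := @Delta_gt _ _ p_gt0 _ _ p'_ge0 e0p'_eq n 2.
  by rewrite -/P -N0E => /(_ ltn); rewrite -/D; lia.
split; first exact: D_sym.
split.
  (* The lower bound at [n] is the upper bound at [N0 - n], by symmetry. *)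
  by move=> n len; rewrite D_le // andbT D_sym // lerN2 D_le ?leq_subr.
split.
  move=> n _; rewrite D_ge1; split; first by right.
  by case=> // ->; apply: (submonoid_generated _).1.
move=> n x _ nE.
(* The given [x] is an integral expression of [n] with [k = 0], not necessarily reduced, so the
   floors remain. *)
rewrite /D (Delta_expr p_gt0 p'_ge0 e0p'_eq (y := fun i => (x i)%:Z) (k := 0)).
  by rewrite addr0; under [in RHS]eq_bigr do rewrite floor_ratio.
by rewrite mul0r addr0; apply: sum_ratio_nat.
Qed.
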